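(* The infinite family $\mathcal{K}=\{K_2,K_3,K_4,\dots\}$ of all complete graphs is not forcing for any $0<p<1$. That is, for every $0<p<1$ there is a sequence of graphs $G$ on $n\to\infty$ vertices such that for every fixed $j\geq 2$ the number of labeled copies of $K_j$ in $G$ is $(1+o(1))p^{\binom{j}{2}}n^j$, but the sequence is not $p$-quasirandom.
   Context: $K_j$ denotes the complete graph on $j$ vertices. A labeled copy of a graph $H$ in a graph $G$ is an injective map $V(H)\to V(G)$ sending edges of $H$ to edges of $G$. Asymptotic notation $o(1)$ refers to the number of vertices $n$ tending to infinity, all other parameters being fixed. For $0<p<1$, a sequence of graphs $G$ on $n\to\infty$ vertices is called $p$-quasirandom if it has $(1+o(1))pn^2$ labeled edges and $(1+o(1))p^4n^4$ labeled copies of the $4$-cycle $C_4$; equivalently (Chung–Graham–Wilson), for every $c>0$ and every vertex set $S$ with $|S|\geq cn$, the number of labeled edges inside $S$ is $(1+o(1))p|S|^2$. A family of graphs $\mathcal{F}$ is forcing (for $p$) if every sequence of $n$-vertex graphs ($n\to\infty$) containing $(1+o(1))n^{|V(F)|}p^{|E(F)|}$ labeled copies of $F$ for every $F\in\mathcal{F}$ is $p$-quasirandom. *)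

(* Defs.v *)
From HB Require Import structures.
From mathcomp Require Import all_boot all_order all_algebra.
From mathcomp Require Import all_classical all_reals all_analysis.

Set Implicit Arguments.
Unset Strict Implicit.
Unset Printing Implicit Defensive.

Import Order.TTheory GRing.Theory Num.Theory.
Import numFieldNormedType.Exports.

Local Open Scope classical_set_scope.
Local Open Scope ring_scope.

Record sgraph := SGraph {
  vertex :> finType;
  adj : rel vertex;
  adj_sym : symmetric adj;
  adj_irr : irreflexive adj }.

Definition edges (G : sgraph) : {set {set G}} :=
  [set [set e.1; e.2]%SET | e : G * G & adj e.1 e.2]%SET.

Definition complete_adj (j : nat) : rel 'I_j := fun x y => x != y.

Lemma complete_adj_sym j : symmetric (@complete_adj j).
Proof. by move=> x y; rewrite /complete_adj eq_sym. Qed.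

Lemma complete_adj_irr j : irreflexive (@complete_adj j).
Proof. by move=> x; rewrite /complete_adj eqxx. Qed.

Definition complete_graph (j : nat) : sgraph :=
  SGraph (@complete_adj_sym j) (@complete_adj_irr j).

(* [ordS] is the successor modulo 4. *)
Definition cycle4_adj : rel 'I_4 := fun x y => (y == ordS x) || (x == ordS y).

Lemma cycle4_adj_sym : symmetric cycle4_adj.
Proof. by move=> x y; rewrite /cycle4_adj orbC. Qed.

Lemma cycle4_adj_irr : irreflexive cycle4_adj.
Proof. by case=> [[|[|[|[|m]]]] Hm]. Qed.

Definition cycle4 : sgraph := SGraph cycle4_adj_sym cycle4_adj_irr.

Definition labeled_copy (H G : sgraph) (f : {ffun H -> G}) : bool :=
  injectiveb f && [forall x, forall y, adj x y ==> adj (f x) (f y)].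

Definition labeled_copies (H G : sgraph) : nat :=
  #|[set f : {ffun H -> G} | labeled_copy f]%SET|.

Definition order_to_infty (G : nat -> sgraph) : Prop :=
  #|G k| @[k --> \oo] --> \oo.

(* A labeled edge is a labeled copy of K_2, i.e. an ordered pair of adjacent
   vertices.  [f ~_\oo g] is f = (1 + o(1)) g. *)
Definition quasirandom (R : realType) (p : R) (G : nat -> sgraph) : Prop :=
  ((fun k => (labeled_copies (complete_graph 2) (G k))%:R : R)
     ~_\oo (fun k => p * #|G k|%:R ^+ 2)) /\
  ((fun k => (labeled_copies cycle4 (G k))%:R : R)
     ~_\oo (fun k => p ^+ 4 * #|G k|%:R ^+ 4)).

Definition forcing (R : realType) (p : R) (F : sgraph -> Prop) : Prop :=
  forall G : nat -> sgraph,
    order_to_infty G ->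
    (forall H, F H ->
      (fun k => (labeled_copies H (G k))%:R : R)
        ~_\oo (fun k => #|G k|%:R ^+ #|H| * p ^+ #|edges H|)) ->
    quasirandom p G.

Definition complete_family (H : sgraph) : Prop :=
  exists2 j : nat, (2 <= j)%N & H = complete_graph j.

(* Main.v *)
(** The deformed exponential [sum_j p^C(j,2) x^j / j!] has only real negative
    zeros and order 0, so it factors as [prod_i (1 + a_i x)] with [a_i > 0] and
    [sum_i a_i = 1]: the complete multipartite limit graph with parts of
    measure [a_i] has exactly the clique densities [p^C(j,2)].  We use its
    polynomial truncations [sum_j C(N,j) p^C(j,2) x^j], which are real-rooted
    by an interlacing induction, and round the parts to integer sizes.  In a
    complete multipartite graph the 4-cycle density [c4] satisfies
    [2 c4 = k2^2 + k4], here [p^2 + p^6 > 2 p^4], so the graphs are not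
    quasirandom. *)

Require Import Defs.
From mathcomp Require Import all_boot all_order all_algebra.
From mathcomp Require polyrcf.
From mathcomp Require Import zify ring lra.
From mathcomp Require Import all_classical all_reals all_analysis.
Import Order.TTheory GRing.Theory Num.Theory.
Import numFieldNormedType.Exports.
Local Open Scope classical_set_scope.
Local Open Scope ring_scope.

(** * Elementary symmetric polynomials and Vieta's formula *)

Definition elsym {R : comNzRingType} {I : finType} (j : nat) (a : I -> R) : R :=
  \sum_(J : {set I} | #|J| == j) \prod_(i in J) a i.

Lemma elsym0 {R : comNzRingType} {I : finType} (a : I -> R) : elsym 0 a = 1.
Proof.
rewrite /elsym (big_pred1 finset.set0) ?big_set0 // => J.
by rewrite cards_eq0.
Qed.

Lemma elsym1 {R : comNzRingType} {I : finType} (a : I -> R) :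
  elsym 1 a = \sum_i a i.
Proof.
rewrite /elsym (reindex_omap finset.set1 (fun J : {set I} => [pick x in J])) /=.
  apply: eq_big => [i|i _]; last by rewrite big_set1.
  rewrite cards1 eqxx /=; case: pickP => [x|/(_ i)]; last by rewrite !inE eqxx.
  by rewrite !inE => /eqP->; apply/eqP.
move=> J /cards1P[x ->]; case: pickP => [y|/(_ x)]; last by rewrite !inE eqxx.
by rewrite !inE => /eqP->.
Qed.

Lemma elsym_gt {R : comNzRingType} {I : finType} (j : nat) (a : I -> R) :
  (#|I| < j)%N -> elsym j a = 0.
Proof.
move=> ltIj; apply: big_pred0 => J; apply: negbTE.
by rewrite neq_ltn (leq_ltn_trans (max_card _) ltIj).
Qed.

Lemma elsymZ {R : comNzRingType} {I : finType} (j : nat) (c : R) (a : I -> R) :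
  elsym j (fun i => c * a i) = c ^+ j * elsym j a.
Proof.
rewrite /elsym big_distrr; apply: eq_bigr => J /eqP <-.
by rewrite big_split /= prodr_const.
Qed.

(** Vieta's formula: the product is expanded over the set [J] of factors that contribute their
    constant term. *)
Lemma coef_prod_XsubC {R : comNzRingType} {I : finType} (j : nat) (a : I -> R) :
  (j <= #|I|)%N ->
  (\prod_i ('X - (a i)%:P))`_(#|I| - j) = (-1) ^+ j * elsym j a.
Proof.
move=> lejI; under eq_bigr => i _ do rewrite addrC.
rewrite bigA_distr coef_sum /elsym big_distrr [RHS]big_mkcond /=.
apply: eq_bigr => J _.
have -> : \prod_i (if i \in J then - (a i)%:P else 'X) =
    (\prod_(i in J) - a i) *: 'X^(#|I| - #|J|) :> {poly R}.
  rewrite (bigID (mem J)) /=.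
  under eq_bigr => i iJ do rewrite iJ -polyCN.
  rewrite -rmorph_prod mul_polyC; congr (_ *: _).
  under eq_bigr => i /negbTE iJ do rewrite iJ.
  rewrite prodr_const; congr (_ ^+ _).
  by rewrite -[in RHS](cardC J) addKn.
rewrite coefZ coefXn prodrN.
have leJI : (#|J| <= #|I|)%N by apply: max_card.
have -> : (#|I| - j == #|I| - #|J|)%N = (#|J| == j) by lia.
by case: eqP => [->|]; rewrite ?mulr1 ?mulr0.
Qed.

(** * Real-rootedness by interlacing *)

(** Exactly the first [k] factors are negative, and each absorbs one factor [-1]. *)
Lemma sign_prod_sub {R : realDomainType} (N k : nat) (t : R) (a : nat -> R) :
  (k <= N)%N -> (forall i, (i < k)%N -> t < a i) ->
  (forall i, (k <= i < N)%N -> a i < t) ->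
  0 < (-1) ^+ k * \prod_(i < N) (t - a i).
Proof.
move=> lekN lt_t gt_t.
rewrite -(big_mkord xpredT (fun i => t - a i)) (big_cat_nat _ lekN) //=.
have -> : (-1) ^+ k = \prod_(0 <= i < k) (-1) :> R.
  by rewrite prodr_const_nat subn0.
rewrite mulrA -big_split /= mulr_gt0 // big_nat prodr_gt0 // => i /andP[i1 i2].
- by rewrite mulN1r opprB subr_gt0 lt_t.
- by rewrite subr_gt0 gt_t ?i1.
Qed.

(** Since [p < 1] and [a l] is positive for [l < N], the one-step gaps chain. The range includes
    [l = N], where [a] may vanish. *)
Lemma lt_scale_of_step {R : realDomainType} (p : R) (N : nat) (a : nat -> R) :
  p < 1 -> (forall i, (i < N)%N -> 0 < a i) ->
  (forall i, (i < N)%N -> a i.+1 < p * a i) ->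
  forall i l, (i < l <= N)%N -> a l < p * a i.
Proof.
move=> p1 a0 apa i; elim=> [//|l IHl] /andP[]; rewrite ltnS leq_eqVlt.
move=> /predU1P[<-|ltil] ltlN; first exact: apa.
apply: (lt_trans (apa _ ltlN)); apply: le_lt_trans (IHl _); last by rewrite ltil ltnW.
by rewrite ler_piMl ?ltW ?a0.
Qed.

(* The polynomial [Q] on the right of the last equation is negative or positive
   according to the parity of [i] at [a i] and opposite at [p * a (i-1)], so it
   has a root [b i] in between; [b 0] lies beyond [a 0]. *)
Lemma interlacing_roots {R : rcfType} (p : R) (N : nat) (a : nat -> R) :
  0 < p -> p < 1 ->
  (forall i, (i < N)%N -> 0 < a i) -> a N = 0 ->
  (forall i, (i < N)%N -> a i.+1 < p * a i) ->
  exists b : nat -> R,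
    [/\ forall i, (i < N.+1)%N -> 0 < b i, b N.+1 = 0,
        forall i, (i < N.+1)%N -> b i.+1 < p * b i
      & \prod_(i < N.+1) ('X - (b i)%:P) =
        'X * \prod_(i < N) ('X - (a i)%:P) - \prod_(i < N) ('X - (p * a i)%:P)].
Proof.
move=> p0 p1 a0 aN apa.
set Q := 'X * _ - _.
have sepa := lt_scale_of_step p N a p1 a0 apa.
have age0 i : (i <= N)%N -> 0 <= a i.
  by rewrite leq_eqVlt => /predU1P[->|/a0/ltW//]; rewrite aN.
have pa_lt i : (i < N)%N -> p * a i < a i by move=> /a0 ai0; rewrite gtr_pMl.
have decra i l : (i <= l < N)%N -> a l <= a i.
  rewrite leq_eqVlt => /andP[/predU1P[->//|ltil] ltlN].
  apply/ltW/(lt_trans (sepa i l _)); first by rewrite ltil ltnW.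
  by rewrite pa_lt // (ltn_trans ltil).
have Qh t : Q.[t] = t * \prod_(i < N) (t - a i) - \prod_(i < N) (t - p * a i).
  rewrite hornerD hornerN hornerM hornerX !horner_prod.
  by congr (_ * _ - _); apply: eq_bigr => i _; rewrite hornerXsubC.
(* At [a i] the first product of [Q] vanishes, for [i = N] because of the factor ['X] and [a N = 0].
   In the second, exactly the [i] earlier roots [p * a l] exceed [a i]. *)
have Qlo i : (i <= N)%N -> (-1) ^+ i * Q.[a i] < 0.
  move=> leiN; rewrite Qh.
  have -> : a i * \prod_(l < N) (a i - a l) = 0.
    move: leiN; rewrite leq_eqVlt => /predU1P[->|ltiN]; first by rewrite aN mul0r.
    by rewrite (bigD1 (Ordinal ltiN)) //= subrr mul0r mulr0.
  rewrite sub0r mulrN oppr_lt0.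
  apply: (sign_prod_sub N i (a i) (fun l => p * a l)) => // l.
    by move=> ltli; apply: sepa; rewrite ltli.
  move=> /andP[leil ltlN]; apply: lt_le_trans (pa_lt _ ltlN) _.
  by apply: decra; rewrite leil.
(* At [p * a i] the second product vanishes, and the [i.+1] roots [a 0, ..., a i] of the first
   exceed the argument. *)
have Qup i : (i < N)%N -> (-1) ^+ i * Q.[p * a i] < 0.
  move=> ltiN; rewrite Qh.
  have -> : \prod_(l < N) (p * a i - p * a l) = 0.
    by rewrite (bigD1 (Ordinal ltiN)) //= subrr mul0r.
  rewrite subr0 mulrCA nmulr_llt0; last first.
    rewrite -oppr_gt0 -mulNr -[- _ ^+ _]mulN1r -exprS.
    apply: (sign_prod_sub N i.+1 (p * a i) a) => // l.
      rewrite ltnS => leli; apply: lt_le_trans (pa_lt _ ltiN) _.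
      by apply: decra; rewrite leli.
    by move=> /andP[ltil ltlN]; apply: sepa; rewrite ltil ltnW.
  by rewrite mulr_gt0 ?a0.
have szA (c : nat -> R) : size (\prod_(i < N) ('X - (c i)%:P)) = N.+1.
  by rewrite size_prod_XsubC /index_enum -enumT size_enum_ord.
have mA (c : nat -> R) : lead_coef (\prod_(i < N) ('X - (c i)%:P)) = 1.
  by apply/eqP/monic_prod_XsubC.
have szXA : size ('X * \prod_(i < N) ('X - (a i)%:P)) = N.+2.
  by rewrite ['X * _]mulrC size_mulX ?szA // -lead_coef_eq0 mA oner_eq0.
have lt_size : (size (- \prod_(i < N) ('X - (p * a i)%:P))%R <
    size ('X * \prod_(i < N) ('X - (a i)%:P))%R)%N.
  by rewrite size_polyN szXA (szA (fun i => p * a i)).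
have szQ : size Q = N.+2 by rewrite size_polyDl.
have mQ : lead_coef Q = 1.
  by rewrite lead_coefDl // lead_coefM lead_coefX mul1r mA.
(* The default 0 beyond [N] provides [b N.+1 = 0], the end value that the induction carries
   along. *)
have /boolp.choice[b Pb] (i : nat) : exists x,
    ((i <= N)%N -> [/\ a i < x, root Q x & (0 < i)%N -> x < p * a i.-1]) /\
    ((N < i)%N -> x = 0).
  have [leiN|ltNi] := leqP i N; last by exists 0.
  case: i leiN => [_|i ltiN].
    (* For [i = 0] there is no [p * a i.-1] to bound the root from above. Instead, [Q] is monic,
       hence positive from some [M] on, while it is negative at [a 0]. *)
    have [|M QM] := @polyrcf.poly_pinfty_gt_lc _ Q; first by rewrite mQ.
    have [||x] := @polyrcf.poly_ivtoo _ Q (a 0%N) (Num.max M (a 0%N)).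
    - by rewrite le_max lexx orbT.
    - rewrite nmulr_rlt0; last by have := Qlo 0%N isT; rewrite mul1r.
      by apply: lt_le_trans (QM _ _); rewrite ?mQ ?ltr01 // le_max lexx.
    by rewrite in_itv => /andP[a0x _] Qx; exists x.
  have [||x] := @polyrcf.poly_ivtoo _ Q (a i.+1) (p * a i).
  - exact/ltW/apa.
  - have := Qlo _ ltiN; have := Qup _ ltiN; rewrite exprS mulN1r mulNr oppr_lt0.
    move=> u l; have : ((-1) ^+ i * Q.[p * a i]) * ((-1) ^+ i * Q.[a i.+1]) < 0.
      by rewrite nmulr_rlt0.
    by rewrite mulrACA -expr2 sqrr_sign mul1r mulrC.
  by rewrite in_itv => /andP[ax xa] Qx; exists x.
have b0 i : (i < N.+1)%N -> 0 < b i.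
  rewrite ltnS => leiN; have [/(_ leiN)[aib _ _] _] := Pb i.
  exact: le_lt_trans (age0 _ leiN) aib.
(* For [i < N] the old root separates the new ones: [b i.+1 < p * a i < p * b i]. *)
have bpb i : (i < N.+1)%N -> b i.+1 < p * b i.
  move=> leiN; have [/(_ leiN)[aib _ _] _] := Pb i.
  have [ltiN|ltNi] := ltnP i N.
    have [/(_ ltiN)[_ _ /(_ isT) bpa] _] := Pb i.+1.
    by apply: lt_trans bpa _; rewrite ltr_pM2l.
  by have [_ ->//] := Pb i.+1; rewrite mulr_gt0 ?b0.
exists b; split=> //; first by have [_ ->] := Pb N.+1.
have sepb := lt_scale_of_step p N.+1 b p1 b0 bpb.
have decrb i l : (i < l < N.+1)%N -> b l < b i.
  move=> /andP[ltil ltlN]; apply: (lt_trans (sepb i l _)); first by rewrite ltil ltnW.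
  by rewrite gtr_pMl ?b0 // (ltn_trans ltil).
(* A monic polynomial of degree [N.+1] with the [N.+1] distinct roots [b i] is the product of its
   linear factors. *)
have := @all_roots_prod_XsubC _ Q [seq b i | i : 'I_N.+1].
rewrite mQ scale1r size_image card_ord szQ => -> //; first 1 last.
- by apply/allP => _ /mapP[i _ ->]; have [/(_ (ltn_ord i))[]] := Pb i.
- rewrite uniq_rootsE map_inj_uniq ?enum_uniq // => i l /= ebil; apply: val_inj => /=.
  have [ltil|ltli|//] := ltngtP i l.
    by have := decrb i l; rewrite ltil ltn_ord ebil ltxx => /(_ isT).
  by have := decrb l i; rewrite ltli ltn_ord ebil ltxx => /(_ isT).
by rewrite big_image.
Qed.

(* Since [prod_i (X - p a_i)] has the coefficients of [prod_i (X - a_i)] scaled by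
   powers of [p], passing from [a] to [b] in [interlacing_roots] turns [elsym j a]
   into [elsym j a + p^(j-1) elsym (j-1) a]: this is Pascal's rule for
   [p^C(j,2) C(N,j)]. *)
Lemma exists_elsym {R : rcfType} (p : R) (N : nat) : 0 < p -> p < 1 ->
  exists a : 'I_N -> R, (forall i, 0 < a i) /\
    forall j, elsym j a = p ^+ 'C(j, 2) * 'C(N, j)%:R.
Proof.
move=> p0 p1.
(* The induction also needs the gap condition, with a terminal zero at index [N]. *)
suff [a [a0 _ _ ea]] : exists a : nat -> R,
    [/\ forall i, (i < N)%N -> 0 < a i, a N = 0,
        forall i, (i < N)%N -> a i.+1 < p * a i
      & forall j, elsym j (fun i : 'I_N => a i) = p ^+ 'C(j, 2) * 'C(N, j)%:R].
  by exists (fun i => a i); split=> // i; apply: a0.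
elim: N => [|N [a [a0 aN apa ea]]].
  exists (fun=> 0); split=> // -[|j]; first by rewrite elsym0 mulr1.
  by rewrite elsym_gt ?card_ord // mulr0.
have [b [b0 bN bpb Qb]] := interlacing_roots p N a p0 p1 a0 aN apa.
exists b; split=> // j.
have [ltNj|lejN] := ltnP N.+1 j.
  by rewrite elsym_gt ?card_ord // (@bin_small N.+1 j) // mulr0.
case: j lejN => [_|j lejN]; first by rewrite elsym0 mulr1.
apply: (@mulfI _ ((-1) ^+ j.+1)); first by rewrite signr_eq0.
have := coef_prod_XsubC j.+1 (fun i : 'I_N.+1 => b i).
rewrite card_ord => <- //; rewrite Qb coefB coefXM subSS.
have cp := coef_prod_XsubC j (fun i : 'I_N => p * a i).
rewrite card_ord in cp; rewrite cp // elsymZ ea (binS N j) natrD.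
rewrite (binS j 1) bin1 exprD.
(* For [j = N] the constant coefficient of a multiple of ['X] is 0, in agreement with [elsym N.+1]
   of only [N] numbers. *)
have -> : (if (N - j == 0)%N then 0 else
  (\prod_(i < N) ('X - (a i)%:P))`_(N - j).-1) =
    (-1) ^+ j.+1 * elsym j.+1 (fun i : 'I_N => a i).
  have [eN|ltjN] := eqVneq (N - j)%N 0.
    by rewrite elsym_gt ?mulr0 // card_ord; lia.
  have := coef_prod_XsubC j.+1 (fun i : 'I_N => a i).
  by rewrite card_ord subnS => -> //; lia.
rewrite ea (binS j 1) bin1 exprD exprS; ring.
Qed.

(** * Cliques and 4-cycles in complete multipartite graphs *)

Section Multipartite.
Context {V I : finType} (c : V -> I).

Definition multipartite_adj : rel V := fun u v => c u != c v.

Lemma multipartite_adj_sym : symmetric multipartite_adj.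
Proof. by move=> u v; rewrite /multipartite_adj eq_sym. Qed.

Lemma multipartite_adj_irr : irreflexive multipartite_adj.
Proof. by move=> u; rewrite /multipartite_adj eqxx. Qed.

Definition multipartite : sgraph :=
  SGraph multipartite_adj_sym multipartite_adj_irr.

Lemma multipartite_complete_copy (j : nat) (f : {ffun complete_graph j -> multipartite}) :
  labeled_copy f = injectiveb (c \o f).
Proof.
apply/andP/injectiveP => [[/injectiveP injf /forallP adjf] x y /= cxy|injcf].
  apply/eqP/negPn/negP => neqxy; have /forallP/(_ y)/implyP/(_ neqxy) := adjf x.
  by rewrite /= /multipartite_adj cxy eqxx.
split; first by apply/injectiveP => x y fxy; apply: injcf; rewrite /= fxy.
apply/forallP => x; apply/forallP => y; apply/implyP => neqxy.
by apply: contra_neq neqxy => cxy; apply: injcf.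
Qed.

(** Copies are grouped by their colour pattern [g]; those with a given pattern choose a vertex
    freely in each prescribed class. *)
Lemma multipartite_complete_copies (j : nat) :
  labeled_copies (complete_graph j) multipartite =
  \sum_(g : {ffun 'I_j -> I} | injectiveb g) \prod_x #|[pred v | c v == g x]|.
Proof.
rewrite /labeled_copies.
under eq_finset => f do rewrite multipartite_complete_copy.
rewrite cardsE -sum1_card.
rewrite (partition_big (fun f : {ffun 'I_j -> V} => [ffun x => c (f x)])
  (fun g => injectiveb g)) /=; last first.
  move=> f /injectiveP injf; apply/injectiveP => x y; rewrite !ffunE; exact: injf.
apply: eq_bigr => g injg; rewrite sum1_card.
transitivity #|family (fun x => [pred v | c v == g x])|.
  apply: eq_card => f; rewrite !inE unfold_in; apply/andP/familyP => [[_ /eqP <-] x|cf].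
    by rewrite inE ffunE.
  have eg x : c (f x) = g x by apply/eqP; have := cf x; rewrite inE.
  split; last by apply/eqP/ffunP => x; rewrite ffunE.
  by apply/injectiveP => x y /=; rewrite !eg; apply/injectiveP.
by rewrite card_family foldrE big_image.
Qed.

(** This and the next two predicates describe homomorphisms, not copies: in [color_cycle] and
    [color_matching] vertices may coincide, which makes the identity below exact. *)
Definition color_cycle (x y z t : V) : bool :=
  [&& c x != c y, c y != c z, c z != c t & c t != c x].

Definition color_matching (x y z t : V) : bool := (c x != c y) && (c z != c t).

Definition color_clique (x y z t : V) : bool :=
  [&& c x != c y, c x != c z, c x != c t, c y != c z, c y != c t & c z != c t].

Definition count4 (P : V -> V -> V -> V -> bool) : nat :=
  \sum_x \sum_y \sum_z \sum_t P x y z t.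

Lemma count4_swap_mid P : count4 (fun x y z t => P x z y t) = count4 P.
Proof. by apply: eq_bigr => x _; rewrite exchange_big. Qed.

Lemma count4_swap_last P : count4 (fun x y z t => P x y t z) = count4 P.
Proof. by apply: eq_bigr => x _; apply: eq_bigr => y _; rewrite exchange_big. Qed.

(* The three terms of each sum run over the three 4-cycles, respectively the
   three perfect matchings, on four labeled points. *)
Lemma color_cycle_matching_clique x y z t :
  (2 * (color_cycle x y z t + color_cycle x z y t + color_cycle x y t z) =
   color_matching x y z t + color_matching x z y t + color_matching x t y z +
   3 * color_clique x y z t)%N.
Proof.
rewrite /color_cycle /color_matching /color_clique.
move: (c x) (c y) (c z) (c t) => {}x {}y {}z {}t.
(* Transitivity forbids exactly two equalities among three colours. With this constraint on the four
   triples, the identity is checked on the six Boolean values. *)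
have tri (u v w : I) : ((u == v) + (v == w) + (u == w) != 2)%N.
  case: (eqVneq u v) => [<-|uv]; first by case: (u == w).
  by case: (eqVneq v w) => [<-|_]; [rewrite (negbTE uv) | case: (u == w)].
move: (tri x y z) (tri x y t) (tri x z t) (tri y z t).
rewrite ![t == _]eq_sym ![z == y]eq_sym [z == x]eq_sym.
by case: (x == y); case: (x == z); case: (x == t);
  case: (y == z); case: (y == t); case: (z == t).
Qed.

(** Summed over all quadruples, the three terms of each kind in the pointwise identity become equal
    by exchanging summations, so a factor 3 cancels. *)
Lemma count4_cycle : (2 * count4 color_cycle =
  count4 color_matching + count4 color_clique)%N.
Proof.
suff : (3 * (2 * count4 color_cycle) =
    3 * (count4 color_matching + count4 color_clique))%N by lia.
transitivity (2 * (count4 color_cycle + count4 (fun x y z t => color_cycle x z y t) +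
   count4 (fun x y z t => color_cycle x y t z)))%N.
  by rewrite (count4_swap_mid color_cycle) (count4_swap_last color_cycle); lia.
transitivity (count4 color_matching + count4 (fun x y z t => color_matching x z y t) +
   count4 (fun x y z t => color_matching x t y z) + 3 * count4 color_clique)%N; last first.
  rewrite (count4_swap_last (fun x y z t => color_matching x z y t)).
  by rewrite (count4_swap_mid color_matching); lia.
rewrite /count4 -!big_split !big_distrr -big_split; apply: eq_bigr => x _.
rewrite /= -!big_split !big_distrr -big_split; apply: eq_bigr => y _.
rewrite /= -!big_split !big_distrr -big_split; apply: eq_bigr => z _.
rewrite /= -!big_split !big_distrr -big_split; apply: eq_bigr => t _.
exact: color_cycle_matching_clique.
Qed.

Lemma sum_ffun2 (F : {ffun 'I_2 -> V} -> nat) :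
  (\sum_f F f = \sum_x \sum_y F [ffun i => tnth [tuple x; y] i])%N.
Proof.
rewrite pair_big /=.
apply: (reindex (fun x : V * V => [ffun i => tnth [tuple x.1; x.2] i])).
exists (fun f : {ffun 'I_2 -> V} => (f ord0, f ord_max)) => [[x y] _|f _].
  by rewrite !ffunE.
by apply/ffunP => -[[|[|//]] i]; rewrite !ffunE /=; congr (f _); apply: val_inj.
Qed.

Lemma sum_ffun4 (F : {ffun 'I_4 -> V} -> nat) :
  (\sum_f F f =
   \sum_x \sum_y \sum_z \sum_t F [ffun i => tnth [tuple x; y; z; t] i])%N.
Proof.
rewrite 3!pair_big /=.
apply: (reindex (fun x : V * V * V * V =>
  [ffun i => tnth [tuple x.1.1.1; x.1.1.2; x.1.2; x.2] i])).
exists (fun f : {ffun 'I_4 -> V} =>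
    (f ord0, f (inord 1), f (inord 2), f ord_max)) => [[[[x y] z] t] _|f _].
  by rewrite !ffunE !(tnth_nth x) /= !inordK.
apply/ffunP => -[[|[|[|[|//]]]] i]; rewrite !ffunE !(tnth_nth (f ord0)) /=;
  by congr (f _); apply: val_inj; rewrite /= ?inordK.
Qed.

Lemma injectiveb_tuple {T : eqType} (n : nat) (d : V -> T) (s : n.-tuple V) :
  injectiveb (d \o [ffun i => tnth s i]) = uniq (map d s).
Proof.
rewrite /injectiveb /dinjectiveb; congr uniq.
rewrite -[in RHS](map_tnth_enum s) -map_comp.
by apply: eq_map => i; rewrite /= ffunE.
Qed.

(** Neighbours on the cycle have different colours, so a homomorphism of the 4-cycle can only fail
    to be injective by identifying opposite vertices. *)
Lemma color_cycle_copy x y z t :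
  (color_cycle x y z t <=
   @labeled_copy cycle4 multipartite [ffun i => tnth [tuple x; y; z; t] i] +
   (x == z) + (y == t))%N.
Proof.
case: (eqVneq x z) => [_|xz]; first by apply: leq_trans (leq_b1 _) _; rewrite addn1.
case: (eqVneq y t) => [_|yt]; first by apply: leq_trans (leq_b1 _) _; rewrite addn1.
rewrite !addn0; case: (boolP (color_cycle _ _ _ _)) => // /and4P[xy yz zt tx].
have neqc u v : c u != c v -> u != v by apply: contra_neq => ->.
rewrite lt0b; apply/andP; split.
  rewrite (injectiveb_tuple _ id) map_id /= !inE !negb_or xz yt.
  by rewrite (eq_sym x t) !neqc.
apply/forallP => i; apply/forallP => i'; apply/implyP.
have adjS (k : 'I_4) : c ([ffun i => tnth [tuple x; y; z; t] i] k) !=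
    c ([ffun i => tnth [tuple x; y; z; t] i] (ordS k)).
  by rewrite !ffunE !(tnth_nth x) /=; case: k => -[|[|[|[|//]]]].
by move=> /orP[] /eqP ->; rewrite /= /multipartite_adj // eq_sym.
Qed.

(** This is [count4_cycle] for labeled copies. Homomorphisms of complete graphs are already
    injective; for the 4-cycle each of the two pairs of opposite vertices costs at most [#|V| ^ 3],
    and the factor 2 doubles this loss. *)
Lemma multipartite_cycle4_copies :
  (labeled_copies (complete_graph 2) multipartite ^ 2 +
   labeled_copies (complete_graph 4) multipartite <=
   2 * labeled_copies cycle4 multipartite + 4 * #|V| ^ 3)%N.
Proof.
have copiesE (H : sgraph) : labeled_copies H multipartite =
    (\sum_(f : {ffun H -> V}) (@labeled_copy H multipartite f : nat))%N.
  by rewrite /labeled_copies cardsE -sum1_card big_mkcond.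
have K2 : labeled_copies (complete_graph 2) multipartite =
    (\sum_x \sum_y (c x != c y))%N.
  rewrite copiesE (sum_ffun2 (fun f => @labeled_copy (complete_graph 2) multipartite f)).
  apply: eq_bigr => x _; apply: eq_bigr => y _; congr (nat_of_bool _).
  rewrite multipartite_complete_copy; apply/injectiveP/idP => [injf|cxy].
    by apply/eqP => cxy; have /= := injf ord0 ord_max; rewrite !ffunE => /(_ cxy).
  by move=> [[|[|//]] i] [[|[|//]] i'] /= /eqP; rewrite !ffunE /= => exy;
    apply: val_inj => //=; move: exy cxy; rewrite ?[c y == _]eq_sym => ->.
have K4 : labeled_copies (complete_graph 4) multipartite = count4 color_clique.
  rewrite copiesE (sum_ffun4 (fun f => @labeled_copy (complete_graph 4) multipartite f)).
  do 4![apply: eq_bigr => ? _]; congr (nat_of_bool _).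
  rewrite multipartite_complete_copy injectiveb_tuple /= !inE !negb_or.
  by rewrite /color_clique -!andbA andbT.
have C4 : (count4 color_cycle <= labeled_copies cycle4 multipartite + 2 * #|V| ^ 3)%N.
  have sum_eq (x : V) : (\sum_z (x == z) = 1)%N.
    by rewrite (bigD1 x) //= eqxx big1 // => z /negbTE; rewrite eq_sym => ->.
  have eq13 : count4 (fun x y z t => x == z) = (#|V| ^ 3)%N.
    rewrite /count4; under eq_bigr => x _ do under eq_bigr => y _ do
      (under eq_bigr => z _ do rewrite sum_nat_const; rewrite -big_distrr /= sum_eq).
    by rewrite !sum_nat_const !muln1 !expnS expn0 muln1.
  have eq24 : count4 (fun x y z t => y == t) = (#|V| ^ 3)%N.
    rewrite /count4; under eq_bigr => x _ do under eq_bigr => y _ do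
      under eq_bigr => z _ do rewrite sum_eq.
    by rewrite !sum_nat_const !muln1 !expnS expn0 muln1.
  rewrite copiesE (sum_ffun4 (fun f => @labeled_copy cycle4 multipartite f)).
  rewrite mul2n -addnn addnA -{1}eq13 -eq24 /count4.
  do 4![rewrite -!big_split; apply: leq_sum => ? _ /=].
  exact: color_cycle_copy.
rewrite K2 K4.
(* The matching predicate is a conjunction of conditions on disjoint pairs of variables, so its
   count factors. *)
have -> : ((\sum_x \sum_y (c x != c y)) ^ 2 = count4 color_matching)%N.
  rewrite -mulnn big_distrl; apply: eq_bigr => x _ /=.
  rewrite big_distrl; apply: eq_bigr => y _ /=.
  rewrite big_distrr; apply: eq_bigr => z _ /=.
  by rewrite big_distrr; apply: eq_bigr => t _ /=; rewrite mulnb.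
by rewrite -count4_cycle; lia.
Qed.

End Multipartite.


(** * Rounding the weights to integer part sizes *)

(** Each [j]-set is the image of [j!] injections, all with the same product. *)
Lemma sum_injections {R : comNzRingType} {I : finType} (j : nat) (w : I -> R) :
  \sum_(g : {ffun 'I_j -> I} | injectiveb g) \prod_x w (g x) = j`!%:R * elsym j w.
Proof.
rewrite (partition_big (fun g : {ffun 'I_j -> I} => [set g x | x in 'I_j]%SET)
  (fun J : {set I} => #|J| == j)) /=; last first.
  by move=> g /injectiveP injg; rewrite card_imset // card_ord.
rewrite /elsym big_distrr; apply: eq_bigr => J /eqP cJ /=.
transitivity (\sum_(g in [set g : {ffun 'I_j -> I} in ffun_on J | injectiveb g]%SET)
    \prod_(i in J) w i).
  apply: eq_big => [g|g /andP[/injectiveP injg /eqP <-]].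
    rewrite !inE andbC; apply: andb_id2r => /injectiveP injg.
    apply/eqP/ffun_onP => [<- x|gJ]; first by rewrite imset_f.
    apply/eqP; rewrite eqEcard cJ card_imset // card_ord leqnn andbT.
    by apply/fintype.subsetP => _ /imsetP[x _ ->]; apply: gJ.
  by rewrite big_imset //= => x y _ _; apply: injg.
by rewrite sumr_const card_inj_ffuns_on card_ord cJ ffactnn mulr_natl.
Qed.

(** Over all maps the sums are the powers on the right, and every difference of products is
    nonnegative, so restricting to injections only decreases the total. The rounding error is thus
    controlled by the total weights alone. *)
Lemma sum_injections_diff {R : numDomainType} {I : finType} (j : nat) (a b : I -> R) :
  (forall i, 0 <= b i <= a i) ->
  0 <= \sum_(g : {ffun 'I_j -> I} | injectiveb g) \prod_x a (g x) -
    \sum_(g : {ffun 'I_j -> I} | injectiveb g) \prod_x b (g x) <=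
  (\sum_i a i) ^+ j - (\sum_i b i) ^+ j.
Proof.
move=> leba.
have d_ge0 (g : {ffun 'I_j -> I}) : 0 <= \prod_x a (g x) - \prod_x b (g x).
  by rewrite subr_ge0 ler_prod.
have powE (w : I -> R) : (\sum_i w i) ^+ j = \sum_(g : {ffun 'I_j -> I}) \prod_x w (g x).
  by rewrite -(bigA_distr_bigA (fun (x : 'I_j) i => w i)) prodr_const card_ord.
rewrite !powE -!sumrB sumr_ge0 //=.
by rewrite [leRHS](bigID (fun g : {ffun 'I_j -> I} => injectiveb g)) /= lerDl sumr_ge0.
Qed.

Lemma card_edges_complete (j : nat) : #|edges (complete_graph j)| = 'C(j, 2).
Proof.
rewrite -[in RHS](card_ord j) -card_draws; apply: eq_card => A.
rewrite !inE; apply/imsetP/cards2P => [[[x y] /= xy ->]|[x [y [xy ->]]]].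
  by exists x, y; rewrite inE in xy.
by exists (x, y); rewrite // inE.
Qed.

(** The weights [a i] sum to [elsym 1 a = N]. Scaled by [N] they have total [N * N], and rounding
    each of the [N] parts down loses at most [N] vertices, a proportion of at most [1 / N]. *)
Lemma exists_multipartite_clique_counts {R : realType} (p : R) (N : nat) :
  0 < p -> p < 1 ->
  exists G : sgraph,
    [/\ (N * N <= #|G| + N)%N /\ (#|G| <= N * N)%N,
        forall j, N%:R ^+ j * (N ^_ j)%:R * p ^+ 'C(j, 2) -
            ((N * N)%:R ^+ j - #|G|%:R ^+ j) <=
          (labeled_copies (complete_graph j) G)%:R <=
          N%:R ^+ j * (N ^_ j)%:R * p ^+ 'C(j, 2)
      & (labeled_copies (complete_graph 2) G ^ 2 +
          labeled_copies (complete_graph 4) G <=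
          2 * labeled_copies cycle4 G + 4 * #|G| ^ 3)%N].
Proof.
move=> p0 p1; have [a [a_gt0 elsyma]] := exists_elsym p N p0 p1.
pose w i := N%:R * a i; pose n i := Num.truncn (w i).
have w_ge0 i : 0 <= w i by rewrite mulr_ge0 // ltW.
have n_le i : (0 : R) <= (n i)%:R <= w i.
  by rewrite ler0n /=; have /andP[] := Num.Theory.truncn_itv (w_ge0 i).
have n_gt i : w i - 1 <= (n i)%:R.
  by rewrite lerBlDr natr1 ltW // Num.Theory.truncnS_gt.
have sumw : \sum_i w i = (N * N)%:R.
  by rewrite -big_distrr -elsym1 elsyma mul1r bin1 natrM.
pose c (v : {i : 'I_N & 'I_(n i)}) : 'I_N := tag v.
have card_c i : #|[pred v | c v == i]| = n i.
  have -> : #|[pred v | c v == i]| =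
      #|[set (Tagged (fun i => 'I_(n i)) k) | k : 'I_(n i)]%SET|.
    apply: eq_card => v; rewrite inE; apply/eqP/imsetP => [|[k _ ->//]].
    by case: v => i' k /= <-; exists k.
  rewrite card_imset ?card_ord // => k k' /eqP.
  by rewrite eq_Tagged => /eqP.
have card_V : #|{: {i : 'I_N & 'I_(n i)}}| = (\sum_i n i)%N.
  rewrite -sum1_card (partition_big c xpredT) //=; apply: eq_bigr => i _.
  by rewrite sum1_card -(card_c i).
exists (multipartite c); split.
- rewrite /= card_V -2!(ler_nat R) natrD -sumw natr_sum; split.
    rewrite -lerBlDr -[N in N%:R](card_ord N) -sumr_const -sumrB.
    by apply: ler_sum => i _; apply: n_gt.
  by apply: ler_sum => i _; have /andP[] := n_le i.
- move=> j; rewrite multipartite_complete_copies natr_sum.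
  have -> : \sum_(g : {ffun 'I_j -> 'I_N} | injectiveb g)
      (\prod_x #|[pred v | c v == g x]|)%:R =
      \sum_(g : {ffun 'I_j -> 'I_N} | injectiveb g) \prod_x (n (g x))%:R :> R.
    by apply: eq_bigr => g _; rewrite natr_prod; apply: eq_bigr => x _; rewrite card_c.
  have := sum_injections_diff j w (fun i => (n i)%:R) n_le.
  rewrite sumw -natr_sum /= card_V sum_injections elsymZ elsyma.
  have -> : N%:R ^+ j * (N ^_ j)%:R * p ^+ 'C(j, 2) =
      j`!%:R * (N%:R ^+ j * (p ^+ 'C(j, 2) * 'C(N, j)%:R)).
    by rewrite -bin_ffact natrM; ring.
  by move=> /andP[]; rewrite subr_ge0 => -> le; rewrite andbT; lra.
- exact: multipartite_cycle4_copies.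
Qed.

(** * Passage to the limit *)

Lemma equivP_ratio {R : realType} (f g : nat -> R) :
  (\forall k \near \oo, g k != 0) ->
  f ~_\oo g <-> f k / g k @[k --> \oo] --> (1 : R).
Proof.
move=> g0; rewrite eqaddoP; split=> [fg|/cvgrPdist_le fg e e0].
  apply/cvgrPdist_le => e e0; near=> k.
  have gk : g k != 0 by near: k.
  rewrite distrC -[X in _ / _ - X](divff gk) -mulrBl normrM normfV.
  by rewrite ler_pdivrMr ?normr_gt0 //; near: k; apply: fg.
near=> k.
have gk : g k != 0 by near: k.
rewrite -ler_pdivrMr ?normr_gt0 // -normfV -normrM mulrBl divff // distrC.
by near: k; apply: fg.
Unshelve. all: by end_near. Qed.

Lemma cvg_ffact_ratio {R : realType} (j : nat) :
  (k.+1 ^_ j)%:R / k.+1%:R ^+ j @[k --> \oo] --> (1 : R).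
Proof.
elim: j => [|j IHj].
  by under eq_fun => k do rewrite ffactn0 expr0 divr1; apply: cvg_cst.
under eq_fun => k do rewrite ffactnSr natrM exprSr invfM mulrACA.
suff lim1 : (k.+1 - j)%:R / k.+1%:R @[k --> \oo] --> (1 : R).
  by have := cvgM IHj lim1; rewrite mulr1; apply.
apply: (@squeeze_cvgr _ _ _ _ (fun k => 1 - j%:R * k.+1%:R^-1) (fun=> 1)).
- near=> k; apply/andP; split.
    rewrite ler_pdivlMr ?ltr0Sn // mulrBl mul1r mulfVK ?pnatr_eq0 //.
    by rewrite lerBlDr -natrD ler_nat; lia.
  by rewrite ler_pdivrMr ?ltr0Sn // mul1r ler_nat leq_subr.
- have := cvgB (cvg_cst (1 : R)) (cvgMl_tmp (a := j%:R) (@cvg_harmonic R)).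
  by rewrite mulr0 subr0; apply.
- exact: cvg_cst.
Unshelve. all: by end_near. Qed.

Lemma exists_clique_sequence {R : realType} (p : R) : 0 < p -> p < 1 ->
  exists G : nat -> sgraph,
    [/\ forall k, (k <= #|G k|)%N,
        forall j, (labeled_copies (complete_graph j) (G k))%:R / #|G k|%:R ^+ j
          @[k --> \oo] --> p ^+ 'C(j, 2)
      & forall k, (labeled_copies (complete_graph 2) (G k) ^ 2 +
          labeled_copies (complete_graph 4) (G k) <=
          2 * labeled_copies cycle4 (G k) + 4 * #|G k| ^ 3)%N].
Proof.
move=> p0 p1.
have /choice[G HG] k := exists_multipartite_clique_counts p k.+1 p0 p1.
(* With [N = k.+1] there are at least [N * N - N = k.+1 * k] vertices. *)
exists G; split=> [k|j|k]; first by have [[]] := HG k; lia.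
(* [v] compares the order of the graph with the unrounded total [k.+1 * k.+1]. Clique counts are
   first normalized by this total, as [u], and then corrected by [v k ^+ j]. *)
- pose v k : R := #|G k|%:R / (k.+1 * k.+1)%:R.
  have cvg_v : v @ \oo --> (1 : R).
    apply: (@squeeze_cvgr _ _ _ _ (fun k => 1 - k.+1%:R^-1) (fun=> 1)).
    - near=> k; have [[le1 le2] _ _] := HG k.
      rewrite /v ler_pdivrMr ?ltr0n // mul1r ler_nat le2 andbT.
      rewrite ler_pdivlMr ?ltr0n // mulrBl mul1r natrM mulKf ?pnatr_eq0 //.
      by rewrite lerBlDr -natrM -natrD ler_nat.
    - by have := cvgB (cvg_cst (1 : R)) (@cvg_harmonic R); rewrite subr0; apply.
    - exact: cvg_cst.
  have cvg_vX : v k ^+ j @[k --> \oo] --> (1 : R).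
    have := continuous_cvg _ (@exprn_continuous R j 1) cvg_v.
    by rewrite expr1n; apply.
  pose u k : R := (labeled_copies (complete_graph j) (G k))%:R / (k.+1 * k.+1)%:R ^+ j.
  have cvg_u : u @ \oo --> p ^+ 'C(j, 2).
    pose h k : R := ((k.+1 ^_ j)%:R / k.+1%:R ^+ j) * p ^+ 'C(j, 2).
    have cvg_h : h @ \oo --> p ^+ 'C(j, 2).
      have := @cvgMr_tmp _ _ _ _ _ _ (p ^+ 'C(j, 2)) (@cvg_ffact_ratio R j).
      by rewrite mul1r; apply.
    apply: (@squeeze_cvgr _ _ _ _ (fun k => h k - (1 - v k ^+ j)) h) => //.
    - near=> k; have [_ /(_ j) /andP[le1 le2] _] := HG k.
      have N0 : (k.+1%:R : R) ^+ j != 0 by rewrite expf_neq0 // pnatr_eq0.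
      have hE : h k * (k.+1 * k.+1)%:R ^+ j =
          k.+1%:R ^+ j * (k.+1 ^_ j)%:R * p ^+ 'C(j, 2).
        by rewrite /h natrM exprMn; field.
      have vE : v k ^+ j * (k.+1 * k.+1)%:R ^+ j = #|G k|%:R ^+ j.
        by rewrite /v -exprMn divfK ?pnatr_eq0.
      have NN0 : 0 < ((k.+1 * k.+1)%:R : R) ^+ j by rewrite exprn_gt0 ?ltr0n.
      rewrite /u ler_pdivrMr // ler_pdivlMr // hE le2 andbT.
      by rewrite !mulrBl mul1r hE vE.
    - have := cvgB cvg_h (cvgB (cvg_cst (1 : R)) cvg_vX).
      by rewrite subrr subr0; apply.
  have -> : (fun k => (labeled_copies (complete_graph j) (G k))%:R / #|G k|%:R ^+ j) =
      (fun k => u k * (v k ^+ j)^-1).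
    apply/funext => k; rewrite /u /v expr_div_n invf_div mulrA divfK //.
  have := cvgM cvg_u (cvgV (oner_neq0 R) cvg_vX).
  by rewrite invr1 mulr1; apply.
- by have [] := HG k.
Unshelve. all: by end_near. Qed.

(** The bound [k <= n k] makes the comparison sequence nonzero for large [k], so that the
    equivalence becomes a limit of quotients. *)
Lemma equivP_pow {R : realType} (q : R) (j : nat) (f : nat -> R) (n : nat -> nat) :
  0 < q -> (forall k, (k <= n k)%N) ->
  f ~_\oo (fun k => q * (n k)%:R ^+ j) <->
  f k / (n k)%:R ^+ j @[k --> \oo] --> q.
Proof.
move=> q0 n_ge; rewrite equivP_ratio; last first.
  near=> k; apply: mulf_neq0; first by rewrite gt_eqF.
  rewrite expf_neq0 // pnatr_eq0 -lt0n.
  by apply: leq_trans (n_ge k); near: k; exact: nbhs_infty_ge.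
split=> [lim1|limq].
  have := cvgMl_tmp (a := q) lim1; rewrite mulr1.
  under eq_fun => k do rewrite invfM mulrCA mulVKf ?gt_eqF //.
  by apply.
have := cvgMl_tmp (a := q^-1) limq; rewrite mulVf ?gt_eqF //.
under eq_fun => k do rewrite mulrCA -invfM.
by apply.
Unshelve. all: by end_near. Qed.

Theorem theorem3 (R : realType) (p : R) (hp0 : 0 < p) (hp1 : p < 1) :
  ~ forcing p complete_family /\
  exists G : nat -> sgraph,
    [/\ order_to_infty G,
        forall j : nat, (2 <= j)%N ->
          (fun k => (labeled_copies (complete_graph j) (G k))%:R : R)
            ~_\oo (fun k => p ^+ 'C(j, 2) * #|G k|%:R ^+ j)
      & ~ quasirandom p G].
Proof.
suff [G [Ginf Gcliques Gqr]] : exists G : nat -> sgraph,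
    [/\ order_to_infty G,
        forall j : nat, (2 <= j)%N ->
          (fun k => (labeled_copies (complete_graph j) (G k))%:R : R)
            ~_\oo (fun k => p ^+ 'C(j, 2) * #|G k|%:R ^+ j)
      & ~ quasirandom p G].
  split; last by exists G.
  move=> /(_ G Ginf) forcingG; apply/Gqr/forcingG => _ [j j2 ->].
  rewrite card_edges_complete card_ord.
  by under [X in _ ~_\oo X]eq_fun => k do rewrite mulrC; exact: Gcliques.
have [G [G_ge Gcliques GC4]] := exists_clique_sequence p hp0 hp1.
exists G; split.
- apply/cvgnyPge => A; near=> k; apply: leq_trans (G_ge k).
  by near: k; exact: nbhs_infty_ge.
- by move=> j _; apply/(equivP_pow _ _ _ (fun k => #|G k|)) => //; rewrite exprn_gt0.
move=> [_ /(equivP_pow _ _ _ (fun k => #|G k|) (exprn_gt0 _ hp0) G_ge) limC4].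
have limK2 := Gcliques 2%N; have limK4 := Gcliques 4%N.
pose invn k : R := #|G k|%:R^-1.
have lim_inv : invn @ \oo --> (0 : R).
  (* For [k >= 1], [#|G k| >= k] gives [k.+1 <= 2 * #|G k|]. *)
  apply: (@squeeze_cvgr _ _ _ _ (fun=> 0) (fun k => 2 * k.+1%:R^-1)).
  - near=> k; rewrite invr_ge0 ler0n /=.
    have k0 : (0 < k)%N by near: k; exact: nbhs_infty_ge.
    have n0 : (0 < #|G k|)%N by apply: leq_trans (G_ge k).
    rewrite -[2]invrK -invfM lef_pV2 ?posrE ?mulr_gt0 ?invr_gt0 ?ltr0n //.
    rewrite ler_pdivrMl // -natrM ler_nat.
    by have := G_ge k; lia.
  - exact: cvg_cst.
  - by have := cvgMl_tmp (a := 2 : R) (@cvg_harmonic R); rewrite mulr0; apply.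
pose K j k : R := (labeled_copies (complete_graph j) (G k))%:R / #|G k|%:R ^+ j.
pose C k : R := (labeled_copies cycle4 (G k))%:R / #|G k|%:R ^+ 4.
have lower : K 2%N k * K 2%N k + K 4%N k @[k --> \oo] --> p * p + p ^+ 6.
  by have := cvgD (cvgM limK2 limK2) limK4; rewrite binn expr1; apply.
have upper : 2 * C k + 4 * invn k @[k --> \oo] --> 2 * p ^+ 4.
  have := cvgD (cvgMl_tmp (a := 2 : R) limC4) (cvgMl_tmp (a := 4 : R) lim_inv).
  by rewrite mulr0 addr0; apply.
(* Quasirandomness would force this inequality between the limits of the two sides of the 4-cycle
   bound; it fails because the difference is a nonzero square. *)
suff : p * p + p ^+ 6 <= 2 * p ^+ 4.
  apply/negP; rewrite -ltNge -subr_gt0.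
  have -> : p * p + p ^+ 6 - 2 * p ^+ 4 = (p * (1 - p ^+ 2)) ^+ 2 by ring.
  by rewrite exprn_gt0 // mulr_gt0 // subr_gt0 expr_lt1 // ltW.
apply: (ler_cvg_to lower upper).
near=> k.
have n0 : (0 < #|G k|)%N.
  by apply: leq_trans (G_ge k); near: k; exact: nbhs_infty_ge.
have n4 : 0 < (#|G k|%:R : R) ^+ 4 by rewrite exprn_gt0 // ltr0n.
have nz : (#|G k|%:R : R) != 0 by rewrite pnatr_eq0 -lt0n.
rewrite /K /C /invn.
set K2 := (labeled_copies (complete_graph 2) (G k))%:R.
set K4 := (labeled_copies (complete_graph 4) (G k))%:R.
set C4 := (labeled_copies cycle4 (G k))%:R.
set n := #|G k|%:R in n4 nz *.
have leC4 : K2 ^+ 2 + K4 <= 2 * C4 + 4 * n ^+ 3.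
  by rewrite -!natrX -!natrM -!natrD ler_nat; exact: GC4.
have -> : K2 / n ^+ 2 * (K2 / n ^+ 2) + K4 / n ^+ 4 = (K2 ^+ 2 + K4) / n ^+ 4 by field.
have -> : 2 * (C4 / n ^+ 4) + 4 * n^-1 = (2 * C4 + 4 * n ^+ 3) / n ^+ 4 by field.
by rewrite ler_pM2r ?invr_gt0.
Unshelve. all: by end_near. Qed.
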